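(* We have $c(n,n)=2$ for all $n\ge 1$, $c(n,n-1)=2$ for all $n\ge 2$, and, for $n\ge 4$ and $\lfloor\sqrt{n}\rfloor\le k\le n$, $$ c(n,k,\pi)= \begin{cases} 2^{\,n-(k+1)\pi}\,(2^{\pi}-1)\,q(\pi,k-1), & \text{if } 1\le \pi\le \left\lfloor \frac{n}{k+1}\right\rfloor,\\[4pt] 2^{\,n-k\pi}\,q(\pi,k-1), & \text{if } \left\lceil \frac{n+1}{k+1}\right\rceil\le \pi\le \left\lfloor\frac{n}{k}\right\rfloor, \end{cases} $$ and $c(n,k)=\sum_{\pi=1}^{\lfloor n/k\rfloor}c(n,k,\pi)$.
   Context: All sequences here are finite nonempty sequences with terms in $\{2,3\}$ (binary sequences). Juxtaposition is concatenation, and $Y^k$ is $Y$ repeated $k$ times. The curling number $\mathrm{cn}(S)$ of $S$ is the largest integer $k\ge 1$ such that $S=XY^k$ for some (possibly empty) sequence $X$ and some nonempty sequence $Y$. $c(n,k)$ is the number of binary sequences of length $n$ with curling number $k$. For $1\le k\le n$ and $1\le\pi\le n$, $c(n,k,\pi)$ is the number of binary sequences $S$ of length $n$ with curling number $k$ for which the shortest nonempty $Y$ such that $S=XY^k$ for some $X$ has length $\pi$. A sequence is primitive if it is not equal to $T^i$ for any sequence $T$ and integer $i\ge 2$. For $1\le k\le n$, $q(n,k)$ is the number of primitive binary sequences of length $n$ with curling number at most $k$; also $q(n,0)=0$ and $q(n,k)=q(n,n)$ for $k>n$. *)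

(* Defs.v *)
From Stdlib Require Import PeanoNat.
From mathcomp Require Import all_boot boolp.

Set Implicit Arguments.
Unset Strict Implicit.
Unset Printing Implicit Defensive.

Definition letter := seq_sub [:: 2; 3].

Section Sequences.
Variable T : eqType.
Implicit Types S Y Z : seq T.

Definition seq_pow Y k : seq T := flatten (nseq k Y).

(* [suffix s S] holds iff S = X ++ s for some, possibly empty, X. *)
Definition ends_in_power S k Y : Prop := Y <> [::] /\ suffix (seq_pow Y k) S.

(* Y is nonempty, so every admissible exponent is at most size S. Allowing
   the exponent 0 does not affect the maximum. *)
Definition cn S : nat :=
  \max_(k < (size S).+1 | `[< exists Y, ends_in_power S k Y >]) k.

Definition shortest_period S k p : Prop :=
  (exists2 Y, ends_in_power S k Y & size Y = p) /\
  (forall Z, ends_in_power S k Z -> p <= size Z).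

Definition primitive S : Prop := forall Y i, 2 <= i -> S <> seq_pow Y i.

Lemma size_seq_pow Y k : size (seq_pow Y k) = k * size Y.
Proof. by rewrite size_flatten /shape map_nseq sumn_nseq mulnC. Qed.

Lemma ends_in_power_leq S k Y : ends_in_power S k Y -> k <= size S.
Proof.
case=> Y0 /size_suffix; rewrite size_seq_pow; apply: leq_trans.
by rewrite leq_pmulr // lt0n size_eq0; apply/eqP.
Qed.

Lemma cn_max S k Y : ends_in_power S k Y -> k <= cn S.
Proof.
move=> SkY; have kS := ends_in_power_leq SkY; rewrite -ltnS in kS.
by apply: (leq_bigmax_cond (Ordinal kS)); apply/asboolP; exists Y.
Qed.

Lemma cn_gt0 S : S <> [::] -> 0 < cn S.
Proof.
move=> S0; apply: (@cn_max S 1 S); split=> //.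
by rewrite /seq_pow /= cats0 suffix_refl.
Qed.

Lemma cn_ends_in_power S : S <> [::] -> exists Y, ends_in_power S (cn S) Y.
Proof.
move=> S0; rewrite /cn.
have h : 0 < #|[pred k : 'I_(size S).+1 |
                 `[< exists Y, ends_in_power S k Y >]]|.
  apply/card_gt0P; exists ord0; apply/asboolP; exists S.
  by split=> //; exact: suffix0s.
have [k Pk ->] := eq_bigmax_cond (fun k : 'I_(size S).+1 => k : nat) h.
exact/asboolP.
Qed.

End Sequences.

Definition c n k : nat := #|[set S : n.-tuple letter | cn S == k]|.

Definition c_period n k p : nat :=
  #|[set S : n.-tuple letter | (cn S == k) && `[< shortest_period S k p >]]|.

Definition q n k : nat :=
  if k == 0 then 0
  else #|[set S : n.-tuple letter | `[< primitive S >] && (cn S <= minn k n)]|.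

Definition ceil_div m d : nat := m %/ d + ~~ (d %| m).

Lemma ceil_div_leq m d x : 0 < d -> (ceil_div m d <= x) = (m <= x * d).
Proof.
move=> d0; rewrite /ceil_div; case: (boolP (d %| m)) => [dm|ndm] /=.
  by rewrite addn0 leq_divLR.
rewrite addn1 ltn_divLR // ltn_neqAle; case: eqP => //= mE.
by rewrite mE dvdn_mull in ndm.
Qed.

(* Main.v *)
Require Import Defs.
From Stdlib Require Import PeanoNat.
From mathcomp Require Import all_boot boolp.
From mathcomp Require Import zify.

Set Implicit Arguments.
Unset Strict Implicit.
Unset Printing Implicit Defensive.

(** Fix n >= 4 and k with floor(sqrt n) <= k, so that k >= 2 and n < (k+1)^2.
The sequences S of length n with curling number k and shortest period p are
exactly the products X Y^k in which Y is primitive of length p, has curling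
number less than k, and is not a suffix of X ([curling_decomposition]).  Since
(X, Y) can be read off X Y^k once p is known, counting these pairs gives both
cases of the formula: there are q(p, k-1) choices of Y, and for each of them
the sequences X of length n - kp that do not end in Y number
2^(n-(k+1)p) (2^p - 1) if p <= n - kp, and 2^(n-kp) otherwise, X being then too
short to end in Y.

That such a decomposition is necessary is immediate: if Y = T^i with i >= 2
then S ends in T^(ik) with ik > k; if Y ends in Z^k then so does S, with Z
shorter than Y; and if X ends in Y then S ends in Y^(k+1).

The content is sufficiency, where the bound n < (k+1)^2 enters.  Suppose
S = X Y^k as above also ends in a power Z^m with m >= k.  The common suffix of
Y^k and Z^m has periods |Y| and |Z|, and once its length is at least
|Y| + |Z| - 1 the theorem of Fine and Wilf ([fine_wilf]) makes
gcd(|Y|, |Z|) a period of it; as Y is primitive this forces |Y| to divide |Z|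
([primitive_fine_wilf]).

If |Z| < |Y|, then either Z^k fits in Y, which contradicts cn(Y) < k, or the
overlap is long enough, for otherwise |Y| >= (k-1)|Z| + 2 with |Z| >= 3 and
k|Y| would exceed n; but |Y| cannot divide the smaller |Z|
([shortest_power_bound]).  If m = k+1, then (k+1)|Z| <= n < (k+1)^2 gives
|Z| <= k, which makes the overlap long enough again; hence |Y| divides |Z|,
the suffix Z^(k+1) has period |Y|, and S ends in Y^(k+1), contradicting the
choice of X ([no_higher_power]).

The decomposition holds whenever k >= 2 and n < (k+1)^2, so the count also gives
c(n,n) for n >= 2 and c(n,n-1) for n >= 3, where p = 1 is the only possible
period; c(1,1) and c(2,1) have k = 1 and follow from 1 <= cn(S) <= n. *)

(** * Periods and the theorem of Fine and Wilf *)

(** Comparing each value with the one at the residue of its index, rather than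
with the one p places further, makes it a mere rewriting to replace a period
by a divisor of it. *)
Definition periodic_below (A : Type) (L p : nat) (f : nat -> A) : Prop :=
  forall i, i < L -> f i = f (i %% p).

Section Periodicity.
Variables (A : Type) (f : nat -> A).

Lemma periodic_below_shift L p i :
  periodic_below L p f -> i + p < L -> f (i + p) = f i.
Proof.
move=> fp ipL; rewrite (fp _ ipL) modnDr -fp //.
by apply: leq_ltn_trans ipL; apply: leq_addr.
Qed.

Lemma periodic_below_of_shift L p : 0 < p ->
  (forall i, i + p < L -> f (i + p) = f i) -> periodic_below L p f.
Proof.
move=> p0 fS; elim/ltn_ind=> i IH iL.
case: (ltnP i p) => [ip|pi]; first by rewrite modn_small.
have -> : f i = f (i - p) by rewrite -[in LHS](subnK pi) fS // subnK.
rewrite IH; [|lia|lia].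
by rewrite -[in RHS](subnK pi) modnDr.
Qed.

(** A period d of a single full p-block spreads along the period p, as reduction
modulo d factors through reduction modulo p. *)
Lemma periodic_below_refine L M p d : d %| p -> 0 < p <= M ->
  periodic_below L p f -> periodic_below M d f -> periodic_below L d f.
Proof.
move=> dp /andP[p0 pM] fp fd i iL.
rewrite (fp i iL) fd; last by apply: leq_trans pM; rewrite ltn_mod.
by rewrite modn_dvdm.
Qed.

(** Euclid's algorithm: if p < q, the first L - p values have the periods p and
q - p, because two indices that differ by q - p both reach, by steps of length
q and p, one that is still below L.  Induction gives that these values have the
period gcd(p,q), and they contain a full p-block, whence all of the L values
do. *)
Theorem fine_wilf L p q : 0 < p -> 0 < q -> p + q <= L + gcdn p q ->
  periodic_below L p f -> periodic_below L q f ->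
  periodic_below L (gcdn p q) f.
Proof.
have [s] := ubnP (p + q); elim: s L p q => // s IH L p q.
wlog pq : p q / p <= q.
  move=> W psq p0 q0 pqL fp fq; case: (leqP p q) => [pq|/ltnW qp].
    exact: W.
  by rewrite gcdnC; apply: (W q p) => //; rewrite 1?gcdnC 1?addnC.
move=> pqs p0 q0 pqL fp fq.
move: pq; rewrite leq_eqVlt => /orP[/eqP pq|pq]; first by rewrite -pq gcdnn.
have gE : gcdn p (q - p) = gcdn p q.
  by rewrite -[in RHS](subnK (ltnW pq)) gcdnDr.
have gle : gcdn p q <= q - p by rewrite -gE dvdn_leq ?subn_gt0 // dvdn_gcdr.
have gp : gcdn p q <= p by rewrite dvdn_leq // dvdn_gcdl.
apply: (@periodic_below_refine L (L - p) p) => //; first exact: dvdn_gcdl.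
  by rewrite p0; lia.
rewrite -gE; apply: IH => //; try (rewrite ?gE; lia).
  by move=> i iL; apply: fp; lia.
apply: periodic_below_of_shift; first by lia.
move=> i iL; rewrite -(@periodic_below_shift L p) //; last by lia.
by rewrite -addnA (subnK (ltnW pq)) (periodic_below_shift fq) //; lia.
Qed.

End Periodicity.

(** * Powers as suffixes

Suffixes are read from the right end: [nth x0 (rev S) i] is the letter of S
at distance i from the end, so that all suffixes of S share one indexing. *)

Section Words.
Variables (T : eqType) (x0 : T).
Implicit Types S X Y Z : seq T.

Lemma nth_seq_pow Y k i : i < k * size Y ->
  nth x0 (seq_pow Y k) i = nth x0 Y (i %% size Y).
Proof.
elim: k i => [|k IH] i; first by rewrite mul0n.
rewrite mulSn /seq_pow /= nth_cat => iL.
case: ltnP => iY; first by rewrite modn_small.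
by rewrite IH; [rewrite -[in RHS](subnK iY) modnDr | lia].
Qed.

Lemma rev_seq_pow Y k : rev (seq_pow Y k) = seq_pow (rev Y) k.
Proof. by rewrite /seq_pow rev_flatten map_nseq rev_nseq. Qed.

Lemma seq_powD Y k m : seq_pow Y (k + m) = seq_pow Y k ++ seq_pow Y m.
Proof. by rewrite /seq_pow nseqD flatten_cat. Qed.

Lemma seq_pow_inj Y Z k : 0 < k -> size Y = size Z ->
  seq_pow Y k = seq_pow Z k -> Y = Z.
Proof.
case: k => // k _ YZ /eqP.
by rewrite /seq_pow /= eqseq_cat // => /andP[/eqP].
Qed.

Lemma seq_powM Y k m : seq_pow (seq_pow Y k) m = seq_pow Y (m * k).
Proof.
elim: m => [|m IH] //.
by rewrite mulSn seq_powD -IH.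
Qed.

Lemma suffix_nthP X S :
  suffix X S <-> size X <= size S /\
    forall i, i < size X -> nth x0 (rev S) i = nth x0 (rev X) i.
Proof.
rewrite /suffix prefixE size_rev; split.
  move=> /eqP XS; have sXS : size X <= size S.
    by rewrite -(size_rev X) -XS size_take_min size_rev geq_minr.
  by split=> // i iX; rewrite -XS nth_take.
case=> sXS XS; apply/eqP/(@eq_from_nth _ x0).
  by rewrite size_takel ?size_rev.
by move=> i; rewrite size_takel ?size_rev // => iX; rewrite nth_take ?XS.
Qed.

Lemma suffix_of_suffix X Y S :
  suffix X S -> suffix Y S -> size X <= size Y -> suffix X Y.
Proof.
move=> /suffix_nthP[_ XS] /suffix_nthP[_ YS] XY.
apply/suffix_nthP; split=> // i iX.
by rewrite -YS ?XS //; apply: leq_trans XY.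
Qed.

Lemma suffix_size_inj X Y S :
  suffix X S -> suffix Y S -> size X = size Y -> X = Y.
Proof.
move=> XS YS XY; have /suffixP[W YE] : suffix X Y.
  by apply: suffix_of_suffix XS YS _; rewrite XY.
have /size0nil W0 : size W = 0 by move: XY; rewrite YE size_cat; lia.
by rewrite YE W0.
Qed.

Lemma suffix_powP Y S k :
  suffix (seq_pow Y k) S <-> k * size Y <= size S /\
    forall i, i < k * size Y ->
      nth x0 (rev S) i = nth x0 (rev Y) (i %% size Y).
Proof.
rewrite suffix_nthP size_seq_pow rev_seq_pow.
by split=> -[sS nS]; split=> // i iL; rewrite nS // nth_seq_pow ?size_rev.
Qed.

Lemma suffix_pow_leq Y S j k :
  j <= k -> suffix (seq_pow Y k) S -> suffix (seq_pow Y j) S.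
Proof.
by move=> jk; rewrite -(subnK jk) seq_powD; apply: catl_suffix.
Qed.

Lemma suffix_pow_base Y S k :
  0 < k -> suffix (seq_pow Y k) S -> suffix Y S.
Proof.
by move=> k0 /(suffix_pow_leq k0); rewrite /seq_pow /= cats0.
Qed.

Lemma periodic_suffix_pow Y S k :
  suffix (seq_pow Y k) S ->
  periodic_below (k * size Y) (size Y) (nth x0 (rev S)).
Proof.
move=> /suffix_powP[_ SY] i iL; rewrite SY // SY ?modn_mod //.
by apply: leq_ltn_trans iL; apply: leq_mod.
Qed.

Lemma suffix_pow_periodic S k p : 0 < k -> 0 < p -> k * p <= size S ->
  periodic_below (k * p) p (nth x0 (rev S)) ->
  exists2 Y, suffix (seq_pow Y k) S & size Y = p.
Proof.
move=> k0 p0 kpS Sp.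
have pS : p <= size S by apply: leq_trans kpS; exact: leq_pmull.
exists (drop (size S - p) S); last by rewrite size_drop subKn.
have sD : size (drop (size S - p) S) = p by rewrite size_drop subKn.
apply/suffix_powP; rewrite sD; split=> // i iL; rewrite Sp //.
have /suffix_nthP[_ -> //] : suffix (drop (size S - p) S) S.
  by apply/suffixP; exists (take (size S - p) S); rewrite cat_take_drop.
by rewrite sD ltn_mod.
Qed.

(** A proper such d would exhibit Y as a power with exponent |Y|/d >= 2. *)
Lemma primitive_period Y d : primitive Y -> 0 < size Y -> d %| size Y ->
  periodic_below (size Y) d (nth x0 (rev Y)) -> d = size Y.
Proof.
move=> pY Y0 dY Yd; have d0 := dvdn_gt0 Y0 dY.
have m0 : 0 < size Y %/ d by rewrite divn_gt0 // dvdn_leq.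
have [Z ZY Zd] : exists2 Z, suffix (seq_pow Z (size Y %/ d)) Y & size Z = d.
  by apply: suffix_pow_periodic; rewrite ?divnK.
have YE : seq_pow Z (size Y %/ d) = Y.
  apply: (suffix_size_inj ZY (suffix_refl Y)).
  by rewrite size_seq_pow Zd divnK.
case: (ltnP 1 (size Y %/ d)) => [m2|m1]; first by case: (pY Z _ m2).
by rewrite -(divnK dY) (_ : size Y %/ d = 1) ?mul1n //; lia.
Qed.

(** A power with exponent cn(S) contains the powers with smaller exponents, so
the maximum defining cn is also a threshold. *)
Lemma cn_geP S j : S <> [::] ->
  j <= cn S <-> exists Y, ends_in_power S j Y.
Proof.
move=> S0; split=> [jS|[Y]]; last exact: cn_max.
have [Y [Y0 YS]] := cn_ends_in_power S0.
by exists Y; split=> //; apply: suffix_pow_leq YS.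
Qed.

(** L is a length on which Y^k and Z^m overlap; it has to reach
|Y| + |Z| - 1, which is at least the Fine-Wilf bound whatever the gcd.  The
resulting period gcd(|Y|,|Z|) is a period of Y dividing |Y|, hence is |Y|. *)
Lemma primitive_fine_wilf S Y Z k m L :
  primitive Y -> 0 < size Y -> 0 < size Z -> 0 < k ->
  suffix (seq_pow Y k) S -> suffix (seq_pow Z m) S ->
  L <= k * size Y -> L <= m * size Z -> size Y + size Z <= L.+1 ->
  size Y %| size Z.
Proof.
move=> pY Y0 Z0 k0 YS ZS LY LZ YZL.
have g0 : 0 < gcdn (size Y) (size Z) by rewrite gcdn_gt0 Y0.
have fY : periodic_below L (size Y) (nth x0 (rev S)).
  by move=> i iL; apply: (periodic_suffix_pow YS); apply: leq_trans LY.
have fZ : periodic_below L (size Z) (nth x0 (rev S)).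
  by move=> i iL; apply: (periodic_suffix_pow ZS); apply: leq_trans LZ.
have fg := fine_wilf Y0 Z0 (_ : _ <= L + gcdn _ _) fY fZ.
have {}fg := fg ltac:(lia).
apply/gcdn_idPl; apply: primitive_period => //; first exact: dvdn_gcdl.
have /suffix_nthP[_ YSn] : suffix Y S.
  by apply: suffix_pow_base YS; lia.
move=> i iY; rewrite -!YSn //; first by apply: fg; lia.
by apply: leq_ltn_trans iY; apply: leq_mod.
Qed.

(** * Decomposition of sequences with a large curling number *)

(** If |Z| < |Y| < k|Z|, then Z^k is a long enough overlap for Fine and Wilf
exactly when |Y| <= (k-1)|Z| + 1; the bound on the size of S excludes the larger
values of |Y|. *)
Lemma shortest_power_bound S Y Z k : 2 <= k -> size S < (k + 1) * (k + 1) ->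
  primitive Y -> cn Y < k -> ends_in_power S k Y -> ends_in_power S k Z ->
  size Y <= size Z.
Proof.
move=> k2 nk pY cY [Y0 YS] [Z0 ZS].
have Ypos : 0 < size Y by rewrite lt0n size_eq0; apply/eqP.
have Zpos : 0 < size Z by rewrite lt0n size_eq0; apply/eqP.
case: leqP => // ZY.
have kYn : k * size Y <= size S by have [] := (suffix_powP Y S k).1 YS.
case: (leqP (k * size Z) (size Y)) => [kZ|kZ].
  suff : k <= cn Y by rewrite leqNgt cY.
  apply: (@cn_max _ Y k Z); split=> //.
  apply: suffix_of_suffix ZS _ _; last by rewrite size_seq_pow.
  by apply: suffix_pow_base YS; lia.
suff /dvdn_leq : size Y %| size Z by move=> /(_ Zpos); rewrite leqNgt ZY.
apply: (primitive_fine_wilf (L := k * size Z) pY Ypos Zpos _ YS ZS) => //.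
- by lia.
- by rewrite leq_mul2l (ltnW ZY) orbT.
rewrite leqNgt; apply/negP => big.
(* Here (k-1)|Z| + 2 <= |Y| < k|Z|, so |Y| >= 3(k-1) + 2; then k|Y| <= |S|
   contradicts |S| < (k+1)^2 since k >= 2. *)
have z3 : 3 <= size Z by lia.
have [j kE] : exists j, k = j.+2 by exists (k - 2); lia.
subst k.
have : 3 * j.+1 + 2 <= size Y by nia.
nia.
Qed.

(** A suffix Z^(k+1) has |Z| <= k by the bound on the size, so that Y^k, of
length at least |Y| + (k-1), is a sufficient overlap; the period |Y| then
propagates from Y^k to the whole of Z^(k+1), which is at least as long as
Y^(k+1). *)
Lemma no_higher_power X Y k :
  2 <= k -> size (X ++ seq_pow Y k) < (k + 1) * (k + 1) ->
  primitive Y -> Y <> [::] -> cn Y < k -> ~~ suffix Y X ->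
  forall Z, ~ ends_in_power (X ++ seq_pow Y k) k.+1 Z.
Proof.
set S := X ++ _ => k2 nk pY Y0 cY XY Z [Z0 ZS].
have YS : suffix (seq_pow Y k) S by apply: suffix_suffix.
have Ypos : 0 < size Y by rewrite lt0n size_eq0; apply/eqP.
have Zpos : 0 < size Z by rewrite lt0n size_eq0; apply/eqP.
have YZ : size Y <= size Z.
  apply: (@shortest_power_bound S Y Z k) => //; split=> //.
  by apply: suffix_pow_leq ZS.
have kZn : k.+1 * size Z <= size S by have [] := (suffix_powP Z S k.+1).1 ZS.
have Zk : size Z <= k by nia.
have dYZ : size Y %| size Z.
  apply: (primitive_fine_wilf (L := k * size Y) pY Ypos Zpos _ YS ZS) => //;
    nia.
have FZ := periodic_suffix_pow ZS.
have FY := periodic_suffix_pow YS.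
have {FZ FY} F : periodic_below (k.+1 * size Z) (size Y) (nth x0 (rev S)).
  by apply: periodic_below_refine dYZ _ FZ FY; nia.
have [||W WS WY] := @suffix_pow_periodic S k.+1 (size Y) isT Ypos.
- by apply: leq_trans kZn; rewrite leq_mul2l YZ orbT.
- by move=> i iL; apply: F; apply: leq_trans iL _; rewrite leq_mul2l YZ orbT.
have WE : W = Y.
  apply: suffix_size_inj (suffix_pow_base _ WS) _ WY => //.
  by apply: suffix_pow_base YS; lia.
by move: WS; rewrite WE /S /seq_pow /= suffix_catl // eqxx (negbTE XY).
Qed.

(** Left to right, any failure of the conditions on X and Y produces either a
power with a larger exponent or a shorter period; right to left is the two
preceding lemmas. *)
Lemma curling_decomposition S k p : 2 <= k -> size S < (k + 1) * (k + 1) ->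
  (cn S = k /\ shortest_period S k p) <->
  exists X Y, [/\ S = X ++ seq_pow Y k, size Y = p, primitive Y, cn Y < k
                & ~~ suffix Y X].
Proof.
move=> k2 nk; split=> [[cS [[Y [Y0 YS] Yp] minp]]|[X [Y [SE Yp pY cY XY]]]].
  have /suffixP[X SE] := YS; exists X, Y; split=> //.
  - move=> Z i i2 YE.
    have Z0 : Z <> [::].
      move=> Z0; apply: Y0; rewrite YE Z0; apply/nilP.
      by rewrite /nilp size_seq_pow muln0.
    suff : k * i <= cn S by rewrite cS; nia.
    by apply: (@cn_max _ S _ Z); split=> //; rewrite -seq_powM -YE.
  - rewrite ltnNge; apply/negP => kY.
    have [Z [Z0 ZY]] := (cn_geP k Y0).1 kY.
    have ZS : ends_in_power S k Z.
      by split=> //; apply: suffix_trans ZY (suffix_pow_base (ltnW k2) YS).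
    have := minp _ ZS; have := size_suffix ZY; rewrite size_seq_pow.
    have : 0 < size Z by rewrite lt0n size_eq0; apply/eqP.
    nia.
  - apply/negP => /suffixP[W XE].
    suff : k.+1 <= cn S by rewrite cS ltnn.
    apply: (@cn_max _ S _ Y); split=> //.
    by rewrite SE XE -catA; apply: suffix_suffix.
have Y0 : Y <> [::].
  by move=> Y0; apply: (pY [::] 2) => //; rewrite Y0.
have YS : ends_in_power S k Y by rewrite SE; split=> //; apply: suffix_suffix.
have S0 : S <> [::].
  by move=> S0; have := ends_in_power_leq YS; rewrite S0 leqn0; case: (k) k2.
split; last first.
  split; first by exists Y.
  by move=> Z ZS; rewrite -Yp; apply: (@shortest_power_bound S Y Z k).
apply/eqP; rewrite eqn_leq (cn_max YS) andbT leqNgt; apply/negP.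
move=> /(cn_geP _ S0) [Z ZS]; subst S.
exact: (no_higher_power k2 nk pY Y0 cY XY ZS).
Qed.

End Words.

(** * Counting *)

(** The encoding takes its values in sequences and not in [n.-tuple T], so that
a concatenation need not be cast along an equation between lengths. *)
Lemma card_tuples_by_encoding (n : nat) (T A : finType) (P : pred (seq T))
    (Q : pred A) (f : A -> seq T) :
  {in Q &, injective f} ->
  (forall s, (size s = n /\ P s) <-> exists2 a, Q a & f a = s) ->
  #|[set S : n.-tuple T | P S]| = #|[set a | Q a]|.
Proof.
move=> f_inj fP; rewrite !cardE -(size_map val) -(size_map f).
apply/perm_size/uniq_perm.
- by rewrite map_inj_uniq ?enum_uniq //; apply: val_inj.
- rewrite map_inj_in_uniq ?enum_uniq // => a b.
  by rewrite !mem_enum !inE; apply: f_inj.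
move=> s; apply/mapP/mapP => [[S]|[a]].
  rewrite mem_enum inE => PS ->.
  have [a Qa fa] := (fP S).1 (conj (size_tuple S) PS).
  by exists a; rewrite ?mem_enum ?inE.
rewrite mem_enum inE => Qa sE.
have [/eqP sn Ps] := (fP s).2 (ex_intro2 _ _ a Qa (esym sE)).
by exists (Tuple sn); rewrite ?mem_enum ?inE.
Qed.

Lemma card_suffix_tuples (T : finType) (m : nat) (Y : seq T) : size Y <= m ->
  #|[set X : m.-tuple T | suffix Y X]| = #|T| ^ (m - size Y).
Proof.
move=> Ym.
rewrite (@card_tuples_by_encoding m T ((m - size Y).-tuple T) (suffix Y) predT
           (fun W => val W ++ Y)).
- by rewrite cardsT card_tuple.
- move=> V W _ _ /eqP; rewrite eqseq_cat ?size_tuple //.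
  by move=> /andP[/eqP /val_inj].
move=> s; split=> [[sm /suffixP[W sE]]|[W _ <-]].
  have /eqP Wm : size W = m - size Y by rewrite -sm sE size_cat addnK.
  by exists (Tuple Wm).
by rewrite size_cat size_tuple subnK // suffix_suffix.
Qed.

Lemma card_nonsuffix_tuples (T : finType) (m : nat) (Y : seq T) : size Y <= m ->
  #|[set X : m.-tuple T | ~~ suffix Y X]|
    = #|T| ^ (m - size Y) * (#|T| ^ size Y - 1).
Proof.
move=> Ym; have := cardsC [set X : m.-tuple T | suffix Y X].
rewrite card_suffix_tuples // card_tuple.
have -> : ~: [set X : m.-tuple T | suffix Y X]
    = [set X : m.-tuple T | ~~ suffix Y X].
  by apply/setP=> X; rewrite !inE.
rewrite mulnBr muln1 -expnD subnK // => <-.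
by rewrite addKn.
Qed.

Lemma card_letter : #|{: letter}| = 2.
Proof. exact: card_seq_sub. Qed.

Lemma card_letter_tuples m : #|[set: m.-tuple letter]| = 2 ^ m.
Proof. by rewrite cardsT card_tuple card_letter. Qed.

Lemma cn_leq_size (T : eqType) (S : seq T) : cn S <= size S.
Proof. by apply/bigmax_leqP => i _; rewrite -ltnS. Qed.

Lemma cn_tuple_leq (T : eqType) n (S : n.-tuple T) : cn S <= n.
Proof. by apply: leq_trans (cn_leq_size S) _; rewrite size_tuple. Qed.

(** A curling number is at most the length, so bounding it by [minn k p] amounts
to bounding it by k. *)
Lemma qE p k : 0 < k ->
  q p k = #|[set S : p.-tuple letter | `[< primitive S >] && (cn S <= k)]|.
Proof.
move=> k0; rewrite /q gtn_eqF //; apply: eq_card => S.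
by rewrite !inE leq_min cn_tuple_leq andbT.
Qed.

(** The number w of admissible X is the same for all Y of length p; its value is
the only difference between the two cases of the formula. *)
Lemma c_periodE n k p w : 2 <= k -> n < (k + 1) * (k + 1) -> k * p <= n ->
  (forall Y : p.-tuple letter, `[< primitive Y >] ->
     #|[set X : (n - k * p).-tuple letter | ~~ suffix Y X]| = w) ->
  c_period n k p = w * q p (k - 1).
Proof.
move=> k2 nk kpn wE.
pose x0 : letter := SeqSub (mem_head 2 [:: 3]).
pose prim_small (Y : p.-tuple letter) := `[< primitive Y >] && (cn Y <= k - 1).
pose avoids (Y : p.-tuple letter) (X : (n - k * p).-tuple letter) :=
  ~~ suffix Y X.
pose Q (YX : p.-tuple letter * (n - k * p).-tuple letter) :=
  prim_small YX.1 && avoids YX.1 YX.2.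
have smallE Y : (cn Y <= k - 1) = (cn Y < k) :> bool.
  by move=> *; lia.
rewrite /c_period (@card_tuples_by_encoding n letter _
   (fun S => (cn S == k) && `[< shortest_period S k p >]) Q
   (fun YX => val YX.2 ++ seq_pow (val YX.1) k)).
- rewrite -sum1dep_card.
  rewrite -(pair_big_dep prim_small avoids (fun _ _ => 1)) /=.
  rewrite qE; last by lia.
  rewrite (eq_bigr (fun _ => w)) => [|Y /andP[pY _]].
    by rewrite sum_nat_cond_const mulnC.
  by rewrite sum1dep_card wE.
- move=> [Y X] [Y' X'] _ _ /= /eqP; rewrite eqseq_cat ?size_tuple //.
  case/andP=> /eqP/val_inj -> /eqP YY'.
  by rewrite (val_inj (seq_pow_inj (ltnW k2) _ YY')) ?size_tuple.
move=> S; split.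
  move=> [Sn /andP[/eqP cS /asboolP pS]].
  rewrite -Sn in nk.
  have [X [Y [SE /eqP Yp pY cY XY]]] :=
    (curling_decomposition x0 p k2 nk).1 (conj cS pS).
  have /eqP Xn : size X = n - k * p.
    by rewrite -Sn SE size_cat size_seq_pow (eqP Yp) addnK.
  exists (Tuple Yp, Tuple Xn) => //=.
  by rewrite /Q /prim_small /avoids /= XY andbT smallE cY andbT; apply/asboolP.
move=> [[Y X] /andP[/andP[/= /asboolP pY cY] XY] SE].
have Sn : size S = n by rewrite -SE size_cat size_seq_pow !size_tuple subnK.
split=> //; rewrite -Sn in nk.
have [] := (curling_decomposition x0 p k2 nk).2 _.
  by exists X, Y; split=> //; rewrite ?size_tuple -?smallE.
by move=> -> pS; rewrite eqxx; apply/asboolP.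
Qed.

Lemma ends_in_power_leq_div (T : eqType) (S Y : seq T) k : 0 < k ->
  ends_in_power S k Y -> 1 <= size Y <= size S %/ k.
Proof.
move=> k0 [/eqP Y0 YS]; rewrite lt0n size_eq0 Y0 leq_divRL //=.
by have := size_suffix YS; rewrite size_seq_pow mulnC.
Qed.

Lemma shortest_period_exists (T : eqType) (S : seq T) k :
  (exists Y, ends_in_power S k Y) -> exists p, shortest_period S k p.
Proof.
move=> [Y SY].
have ex : exists p, `[< exists2 Y, ends_in_power S k Y & size Y = p >].
  by exists (size Y); apply/asboolP; exists Y.
case: (ex_minnP ex) => p /asboolP Sp minp; exists p; split=> // Z SZ.
by apply: minp; apply/asboolP; exists Z.
Qed.

Lemma shortest_period_unique (T : eqType) (S : seq T) k p r :
  shortest_period S k p -> shortest_period S k r -> p = r.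
Proof.
move=> [[Y SY <-] minp] [[Z SZ <-] minr].
by apply/eqP; rewrite eqn_leq minp ?minr.
Qed.

(** Each sequence with curling number k has one shortest period, which lies
between 1 and n/k, so it is counted once on the right. *)
Lemma c_sum_periods n k : 1 <= n -> 1 <= k ->
  c n k = \sum_(1 <= p < (n %/ k).+1) c_period n k p.
Proof.
move=> n1 k1; rewrite /c -sum1dep_card.
under [RHS]eq_bigr do rewrite /c_period -sum1dep_card big_mkcondr.
rewrite exchange_big /=; apply: eq_bigr => S /eqP cS.
have S0 : val S <> [::] by apply/nilP; rewrite /nilp size_tuple -lt0n.
have [|p Sp] := @shortest_period_exists _ S k.
  by rewrite -cS; apply: cn_ends_in_power.
under eq_bigr => r _.
  have -> : `[< shortest_period S k r >] = (r == p).
    apply/asboolP/eqP => [Sr|-> //]; exact: shortest_period_unique Sr Sp.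
  over.
rewrite -big_mkcond sum1_count count_uniq_mem ?iota_uniq // mem_index_iota ltnS.
have [[Y SY <-] _] := Sp.
by have := ends_in_power_leq_div k1 SY; rewrite size_tuple => ->.
Qed.

Lemma c_period_long n k p : 2 <= k -> n < (k + 1) * (k + 1) ->
  (k + 1) * p <= n ->
  c_period n k p = 2 ^ (n - (k + 1) * p) * (2 ^ p - 1) * q p (k - 1).
Proof.
move=> k2 nk kpn; apply: c_periodE => // [|Y _]; first by nia.
rewrite card_nonsuffix_tuples ?size_tuple ?card_letter; last by nia.
by congr (2 ^ _ * _); nia.
Qed.

Lemma c_period_short n k p : 2 <= k -> n < (k + 1) * (k + 1) ->
  k * p <= n < (k + 1) * p -> c_period n k p = 2 ^ (n - k * p) * q p (k - 1).
Proof.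
move=> k2 nk /andP[kpn npk]; apply: c_periodE => // Y _.
rewrite -card_letter_tuples; apply: eq_card => X.
rewrite !inE; apply/negP => /size_suffix; rewrite !size_tuple; nia.
Qed.

Lemma q1 k : 0 < k -> q 1 k = 2.
Proof.
move=> k0; rewrite qE //.
rewrite -[RHS](card_letter_tuples 1); apply: eq_card => S; rewrite !inE.
rewrite (leq_trans (cn_tuple_leq S)) // andbT.
apply/asboolP => Y i i2 SE.
have /eqP := size_tuple S; rewrite SE size_seq_pow muln_eq1 => /andP[/eqP i1 _].
by rewrite i1 in i2.
Qed.

Lemma c_max n : 2 <= n -> c n n = 2.
Proof.
move=> n2; rewrite c_sum_periods ?divnn; try lia.
rewrite (ltnW n2) big_nat1 c_period_short ?q1; try nia.
by rewrite muln1 subnn.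
Qed.

Lemma c_1_1 : c 1 1 = 2.
Proof.
rewrite -[RHS](card_letter_tuples 1); apply: eq_card => S.
rewrite !inE eqn_leq cn_tuple_leq cn_gt0 //.
by case: S => [[]].
Qed.

(** For n = 2 the curling numbers are 1 and 2: complement of c(2,2) = 2. *)
Lemma c_2_1 : c 2 1 = 2.
Proof.
have := cardsC [set S : 2.-tuple letter | cn S == 2].
rewrite -/(c 2 2) c_max // card_tuple card_letter.
have -> : ~: [set S : 2.-tuple letter | cn S == 2]
    = [set S : 2.-tuple letter | cn S == 1].
  apply/setP=> S; rewrite !inE.
  have := cn_tuple_leq S.
  have : 0 < cn S by apply: cn_gt0; case: S => [[]].
  by case: (cn S) => [|[|[]]].
by rewrite -/(c 2 1) => /eqP; rewrite eqn_add2l => /eqP.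
Qed.

Lemma c_pred n : 3 <= n -> c n (n - 1) = 2.
Proof.
case: n => [|[|[|m]]] // _; rewrite subn1 /= c_sum_periods //.
have -> : m.+3 %/ m.+2 = 1.
  by rewrite -[m.+3]addn1 -{1}[m.+2]mul1n divnMDl // divn_small.
rewrite big_nat1 c_period_long ?q1; [|lia|lia|nia|lia].
by rewrite addn1 muln1 subnn.
Qed.

Theorem theorem20 :
  (forall n : nat, 1 <= n -> c n n = 2) /\
  (forall n : nat, 2 <= n -> c n (n - 1) = 2) /\
  (forall n k : nat, 4 <= n -> Nat.sqrt n <= k <= n ->
    (forall p : nat, 1 <= p <= n %/ (k + 1) ->
      c_period n k p = 2 ^ (n - (k + 1) * p) * (2 ^ p - 1) * q p (k - 1)) /\
    (forall p : nat, ceil_div (n + 1) (k + 1) <= p <= n %/ k ->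
      c_period n k p = 2 ^ (n - k * p) * q p (k - 1)) /\
    c n k = \sum_(1 <= p < (n %/ k).+1) c_period n k p).
Proof.
split=> [[|[|n]] // _|]; [exact: c_1_1|exact: c_max|].
split=> [[|[|[|n]]] // _|n k n4 /andP[sk kn]]; [exact: c_2_1|exact: c_pred|].
have [_ nsq] := Nat.sqrt_spec n (Nat.le_0_l n).
have nk : n < (k + 1) * (k + 1) by nia.
have k2 : 2 <= k by nia.
split; [|split].
- move=> p /andP[_]; rewrite leq_divRL ?addn1 // mulnC -addn1 => kpn.
  exact: c_period_long.
- move=> p; rewrite ceil_div_leq ?addn1 // leq_divRL; last by lia.
  by move=> /andP[np pk]; rewrite c_period_short // [k * p]mulnC pk mulnC addn1.
- by apply: c_sum_periods; lia.
Qed.
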